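(* Consider a sequence of experiments indexed by the (even) sample size $n$ in which, for each $n$, treatment is assigned by a paired randomization design with pairing $\rho$, and suppose the regularity conditions (Assumption R in the context) hold. If $d_{\mathrm{avg}}=o(n)$ (restricted interference), $e_{\mathrm{avg}}=o(n)$ (restricted pair-induced interference) and $R_{\mathrm{sum}}=o(n)$ (pair separation), then the Horvitz–Thompson estimator $\hat\tau_{HT}$ and the Hájek estimator $\hat\tau_{HA}$ are consistent for $\tau_{EATE}$ (i.e. their differences from $\tau_{EATE}$ converge to $0$ in probability as $n\to\infty$), and $$\hat\tau_{HT}-\tau_{EATE}=O_p\big(n^{-1/2}d_{\mathrm{avg}}^{1/2}+n^{-1/2}e_{\mathrm{avg}}^{1/2}+n^{-1}R_{\mathrm{sum}}\big),$$ $$\hat\tau_{HA}-\tau_{EATE}=O_p\big(n^{-1/2}d_{\mathrm{avg}}^{1/2}+n^{-1/2}e_{\mathrm{avg}}^{1/2}+n^{-1}R_{\mathrm{sum}}\big).$$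
   Context: Setting. For each sample size $n$ there are units $U=\{1,\dots,n\}$ and arbitrary potential outcome functions $y_i:\{0,1\}^n\to\mathbb R$, $i\in U$. For $\mathbf z\in\{0,1\}^n$, $\mathbf z_{-i}\in\{0,1\}^{n-1}$ is $\mathbf z$ with its $i$th entry deleted, and $y_i(\mathbf z)$ is also written $y_i(z_i;\mathbf z_{-i})$. An experimental design is the probability distribution of a random vector $\mathbf Z=(Z_1,\dots,Z_n)\in\{0,1\}^n$; it is the only source of randomness. Write $Y_i=y_i(\mathbf Z)$ and $p_i=\Pr(Z_i=1)$. All objects depend on $n$, with no relation assumed between different $n$; asymptotics are as $n\to\infty$. Assumption R (regularity conditions). There are constants $k<\infty$, $q\ge 2$, $s\ge 1$ such that for all $n$ and all $i\in U$: $k^{-1}\le \Pr(Z_i=1)\le 1-k^{-1}$; $E[|Y_i|^q]\le k^q$; and $E[|y_i(z;\mathbf Z_{-i})|^s]\le k^s$ for $z\in\{0,1\}$. Paired randomization: $n$ is even, $\rho:U\to U$ is a pairing (an involution without fixed points; $\rho(i)=j$ means $i$ and $j$ are paired), and $\Pr(\mathbf Z=\mathbf z)=2^{-n/2}$ if $z_i\ne z_{\rho(i)}$ for all $i\in U$, and $0$ otherwise. Interference. $I_{ij}=1$ if $i=j$ or if $y_j(\mathbf z)\ne y_j(\mathbf z')$ for some $\mathbf z,\mathbf z'\in\{0,1\}^n$ with $\mathbf z_{-i}=\mathbf z'_{-i}$; otherwise $I_{ij}=0$. $d_{ij}=1$ if $I_{\ell i}I_{\ell j}=1$ for some $\ell\in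 U$, else $d_{ij}=0$; $d_{\mathrm{avg}}=n^{-1}\sum_{i,j=1}^n d_{ij}$. $e_{ij}=1$ if $(1-d_{ij})I_{\ell i}I_{\rho(\ell)j}=1$ for some $\ell\in U$, else $e_{ij}=0$; $e_{\mathrm{avg}}=n^{-1}\sum_{i,j=1}^n e_{ij}$. $R_{\mathrm{sum}}=\sum_{i=1}^n I_{\rho(i)i}$. Estimand: $\tau_{EATE}=n^{-1}\sum_{i=1}^n E[y_i(1;\mathbf Z_{-i})-y_i(0;\mathbf Z_{-i})]$, expectation over the (unconditional) design. Estimators: $\hat\tau_{HT}=\frac1n\sum_i \frac{Z_iY_i}{p_i}-\frac1n\sum_i\frac{(1-Z_i)Y_i}{1-p_i}$ and $\hat\tau_{HA}=\Big(\sum_i\frac{Z_iY_i}{p_i}\Big/\sum_i\frac{Z_i}{p_i}\Big)-\Big(\sum_i\frac{(1-Z_i)Y_i}{1-p_i}\Big/\sum_i\frac{1-Z_i}{1-p_i}\Big)$. $X_n=O_p(a_n)$ means that for every $\varepsilon>0$ there is $M<\infty$ with $\Pr(|X_n|>M a_n)\le\varepsilon$ for all sufficiently large $n$. *)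

(* Defs.v *)
From HB Require Import structures.
From mathcomp Require Import all_boot all_order all_algebra.
From mathcomp Require Import all_classical all_reals all_analysis.

Set Implicit Arguments.
Unset Strict Implicit.
Unset Printing Implicit Defensive.

Import Order.TTheory GRing.Theory Num.Theory.
Import numFieldNormedType.Exports.

Local Open Scope classical_set_scope.
Local Open Scope ring_scope.

(* {0,1}^n, with [true] standing for 1 (treated). *)
Definition assignment (n : nat) := {ffun 'I_n -> bool}.

Definition delete_unit n (i : 'I_n) (z : assignment n) : assignment n.-1 :=
  [ffun k => z (lift i k)].

(* [insert_unit i b w] is the assignment written (b; w) when the i-th unit is
   singled out: entry i is b and deleting it leaves w. *)
Definition insert_unit n (i : 'I_n) (b : bool) (w : assignment n.-1) :
    assignment n :=
  [ffun j => if unlift i j is Some k then w k else b].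

Lemma insert_unitK n (i : 'I_n) (b : bool) : cancel (insert_unit i b) (delete_unit i).
Proof. by move=> w; apply/ffunP=> k; rewrite !ffunE liftK. Qed.

Lemma insert_delete_unit n (i : 'I_n) (b : bool) (z : assignment n) :
  insert_unit i b (delete_unit i z) = [ffun j => if j == i then b else z j].
Proof.
apply/ffunP=> j; rewrite !ffunE; case: unliftP => [k ->|->]; last by rewrite eqxx.
by rewrite ffunE eq_sym (negPf (neq_lift _ _)).
Qed.

(* An experimental design: the law of the random assignment Z. Random variables
   are functions of Z, that is, functions on [assignment n]. *)
Record design (R : realType) (n : nat) := Design {
  law :> assignment n -> R;
  law_ge0 : forall z, 0 <= law z;
  law_sum1 : \sum_z law z = 1 }.

Section FixedSampleSize.
Context {R : realType} {n : nat}.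
Implicit Types (D : design R n) (y : 'I_n -> assignment n -> R).
Implicit Types (rho : 'I_n -> 'I_n) (i j l : 'I_n) (z : assignment n).

Definition Prob D (A : pred (assignment n)) : R := \sum_(z | A z) D z.

Definition Expect D (X : assignment n -> R) : R := \sum_z D z * X z.

Definition ptreat D i : R := Prob D (fun z => z i).

Definition is_pairing rho : Prop := involutive rho /\ forall i, rho i != i.

Definition paired_randomization D rho : Prop :=
  is_pairing rho /\
  forall z, D z = if [forall i, z i != z (rho i)] then 2 ^- n./2 else 0.

(* [interferes y i j] : the treatment of unit i affects the outcome of unit j. *)
Definition interferes y i j : bool :=
  (i == j) ||
  [exists z : assignment n, [exists z' : assignment n,
     (delete_unit i z == delete_unit i z') && (y j z != y j z')]].

Definition interf_dep y i j : bool :=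
  [exists l, interferes y l i && interferes y l j].

Definition d_avg y : R := n%:R^-1 * \sum_i \sum_j (interf_dep y i j)%:R.

Definition pair_interf_dep y rho i j : bool :=
  [exists l,
     [&& ~~ interf_dep y i j, interferes y l i & interferes y (rho l) j]].

Definition e_avg y rho : R :=
  n%:R^-1 * \sum_i \sum_j (pair_interf_dep y rho i j)%:R.

Definition R_sum y rho : R := \sum_i (interferes y (rho i) i)%:R.

Definition tau_EATE D y : R :=
  n%:R^-1 * \sum_i Expect D (fun z =>
    y i (insert_unit i true (delete_unit i z)) -
    y i (insert_unit i false (delete_unit i z))).

(* The indicators Z_i and 1 - Z_i are written [(z i)%:R] and [(~~ z i)%:R]. *)
Definition tau_HT D y z : R :=
  n%:R^-1 * (\sum_i (z i)%:R * y i z / ptreat D i) -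
  n%:R^-1 * (\sum_i (~~ z i)%:R * y i z / (1 - ptreat D i)).

Definition tau_HA D y z : R :=
  (\sum_i (z i)%:R * y i z / ptreat D i) /
    (\sum_i (z i)%:R / ptreat D i) -
  (\sum_i (~~ z i)%:R * y i z / (1 - ptreat D i)) /
    (\sum_i (~~ z i)%:R / (1 - ptreat D i)).

Definition regularity_at (k q s : R) D y : Prop :=
  forall i,
  [/\ k^-1 <= ptreat D i <= 1 - k^-1,
      Expect D (fun z => `|y i z| `^ q) <= k `^ q &
      forall b : bool,
        Expect D (fun z => `|y i (insert_unit i b (delete_unit i z))| `^ s)
          <= k `^ s].

End FixedSampleSize.

(* Sequences below are families over all sample sizes n, of which only the even
   members matter; limits are taken as n tends to infinity along even n. *)
Notation even_oo := (within [set n : nat | ~~ odd n] \oo).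

Section Sequences.
Context {R : realType}.
Implicit Types (D : forall n, design R n) (X : forall n, assignment n -> R).

(* Positivity of k is what makes k^-1, k^q and k^s meaningful. *)
Definition regularity D (y : forall n, 'I_n -> assignment n -> R) : Prop :=
  exists k q s : R,
  [/\ 0 < k, 2 <= q, 1 <= s &
      forall n, ~~ odd n -> regularity_at k q s (D n) (y n)].

Definition cvg_in_prob0 D X : Prop :=
  forall eps : R, 0 < eps ->
  Prob (D n) (fun z => eps < `|X n z|) @[n --> even_oo] --> (0 : R).

Definition bigO_p D X (a : nat -> R) : Prop :=
  forall eps : R, 0 < eps -> exists M : R,
  \forall n \near even_oo, Prob (D n) (fun z => M * a n < `|X n z|) <= eps.

End Sequences.

(* Main.v *)
(* Under paired randomization every p_i is 1/2 and exactly n/2 units are treated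
   almost surely, so the Hajek estimator equals the Horvitz-Thompson estimator
   on the support of the design.  Write tau_HT as the average of
   W_i = 2 (Z_i - (1 - Z_i)) Y_i.  The mean of W_i is the effect of unit i
   whenever the partner of i does not interfere with i, so the total bias is
   O(R_sum / n).  W_i and W_j are independent as soon as the units affecting i,
   together with their partners, are disjoint from those affecting j, i.e.
   unless d_ij = 1 or e_ij = 1; hence the variance is O((d_avg + e_avg) / n).
   Chebyshev's inequality turns the mean square bound into both conclusions. *)
Require Import Defs.
From mathcomp Require Import all_boot all_order all_algebra.
From mathcomp Require Import all_classical all_reals all_analysis.
From mathcomp Require Import ring lra.

Set Implicit Arguments.
Unset Strict Implicit.
Unset Printing Implicit Defensive.

Import Order.TTheory GRing.Theory Num.Theory.
Import numFieldNormedType.Exports.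
Local Open Scope classical_set_scope.
Local Open Scope ring_scope.

(** Below 1 the power is at most 1; above 1 it grows with the exponent. With [m] equal to 2 and 1
    this turns the moment bounds of orders [q] and [s] into bounds on second and first moments
    without Jensen's inequality. *)
Lemma expr_le1D_powR {R : realType} (a r : R) (m : nat) :
  0 <= a -> m%:R <= r -> a ^+ m <= 1 + a `^ r.
Proof.
move=> a0 mr; have [a1|a1] := leP a 1.
  by rewrite (le_trans (exprn_ile1 _ a0 a1)) // lerDl powR_ge0.
rewrite -powR_mulrn // (le_trans (ler_powR (ltW a1) mr)) //.
by rewrite lerDr.
Qed.

(** * Expectation, variance and Chebyshev's inequality on a finite design *)

Section Moments.
Context {R : realType} {n : nat}.
Implicit Types (D : design R n) (X Y : assignment n -> R).

Lemma eq_Expect_supp D X Y :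
  (forall z, D z != 0 -> X z = Y z) -> Expect D X = Expect D Y.
Proof.
move=> XY; apply: eq_bigr => z _.
by have [->|/XY ->//] := eqVneq (D z) 0; rewrite !mul0r.
Qed.

Lemma eq_Expect D X Y : X =1 Y -> Expect D X = Expect D Y.
Proof. by move=> XY; apply: eq_Expect_supp => z _; apply: XY. Qed.

Lemma ExpectD D X Y : Expect D (fun z => X z + Y z) = Expect D X + Expect D Y.
Proof. by rewrite /Expect -big_split; apply: eq_bigr => z _; rewrite mulrDr. Qed.

Lemma ExpectM D (c : R) X : Expect D (fun z => c * X z) = c * Expect D X.
Proof. by rewrite /Expect mulr_sumr; apply: eq_bigr => z _; rewrite mulrCA. Qed.

Lemma ExpectB D X Y : Expect D (fun z => X z - Y z) = Expect D X - Expect D Y.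
Proof. by rewrite /Expect -sumrB; apply: eq_bigr => z _; rewrite mulrBr. Qed.

Lemma Expect_cst D (c : R) : Expect D (fun=> c) = c.
Proof. by rewrite /Expect -mulr_suml law_sum1 mul1r. Qed.

Lemma Expect_sum (I : finType) D (X : I -> assignment n -> R) :
  Expect D (fun z => \sum_i X i z) = \sum_i Expect D (X i).
Proof. by rewrite /Expect exchange_big; apply: eq_bigr => z _; rewrite mulr_sumr. Qed.

Lemma le_Expect D X Y : (forall z, X z <= Y z) -> Expect D X <= Expect D Y.
Proof. by move=> XY; apply: ler_sum => z _; rewrite ler_wpM2l ?law_ge0. Qed.

Lemma ler_norm_Expect D X : `|Expect D X| <= Expect D (fun z => `|X z|).
Proof.
apply: (le_trans (ler_norm_sum _ _ _)); apply: ler_sum => z _.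
by rewrite normrM ger0_norm ?law_ge0.
Qed.

Lemma Expect_sqr_centered D X :
  Expect D (fun z => (X z - Expect D X) ^+ 2) =
  Expect D (fun z => X z ^+ 2) - Expect D X ^+ 2.
Proof.
set m := Expect D X.
rewrite (@eq_Expect D _ (fun z => X z ^+ 2 - (2 * m) * X z + m ^+ 2)); last first.
  by move=> z /=; ring.
by rewrite ExpectD ExpectB ExpectM Expect_cst -/m; ring.
Qed.

Lemma Prob_ge0 D (A : pred (assignment n)) : 0 <= Prob D A.
Proof. by apply: sumr_ge0 => z _; exact: law_ge0. Qed.

Lemma eq_Prob_supp D (A B : pred (assignment n)) :
  (forall z, D z != 0 -> A z = B z) -> Prob D A = Prob D B.
Proof.
move=> AB; rewrite /Prob big_mkcond [RHS]big_mkcond; apply: eq_bigr => z _ /=.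
by have [->|/AB ->//] := eqVneq (D z) 0; rewrite !if_same.
Qed.

Lemma Chebyshev D X (t : R) : 0 < t ->
  Prob D (fun z => t < `|X z|) <= Expect D (fun z => X z ^+ 2) / t ^+ 2.
Proof.
move=> t0; rewrite ler_pdivlMr ?exprn_gt0 // /Prob mulr_suml big_mkcond /=.
apply: ler_sum => z _; case: ifPn => [tX|_].
  rewrite ler_wpM2l ?law_ge0 // -[X z ^+ 2]real_normK ?num_real //.
  by rewrite ler_sqr ?nnegrE ?normr_ge0 ?ltW.
by rewrite mulr_ge0 ?law_ge0 ?sqr_ge0.
Qed.

End Moments.

(** * Outcomes depend only on the interfering units *)

Section Interference.
Context {R : realType} {n : nat}.
Implicit Types (y : 'I_n -> assignment n -> R) (i j l : 'I_n).

Lemma interferes_refl y i : interferes y i i.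
Proof. by rewrite /interferes eqxx. Qed.

Lemma outcome_set1 y i l (z z' : assignment n) :
  ~~ interferes y l i -> (forall j, j != l -> z j = z' j) -> y i z = y i z'.
Proof.
rewrite negb_or => /andP[_ /existsPn/(_ z) /existsPn/(_ z')].
rewrite negb_and negbK => /orP[/eqP nzz' zz'|/eqP //].
case: nzz'; apply/ffunP => k; rewrite !ffunE zz' //.
by rewrite eq_sym neq_lift.
Qed.

(** Interference is defined by changing one coordinate at a time, so the units where the assignments
    disagree are corrected one by one, by induction on their number; none of them affects unit
    [i]. *)
Lemma outcome_local y i (z z' : assignment n) :
  (forall l, interferes y l i -> z l = z' l) -> y i z = y i z'.
Proof.
have [m] := ubnP #|[set l | z l != z' l]%SET|.
elim: m z => // m IH z; rewrite ltnS => zz'm zz'.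
have [zE|] := set_0Vmem [set l | z l != z' l]%SET.
  congr (y i _); apply/ffunP => l; apply/eqP/negPn/negP => zl.
  by move/finset.setP: zE => /(_ l); rewrite !inE zl.
move=> [l]; rewrite inE => zl.
pose z1 : assignment n := [ffun j => if j == l then z' l else z j].
have ln : ~~ interferes y l i by apply: contraNN zl => /zz' ->.
rewrite (@outcome_set1 y i l z z1 ln); last first.
  by move=> j jl; rewrite ffunE (negPf jl).
apply: IH; last first.
  by move=> j ji; rewrite ffunE; case: eqP => [->//|_]; apply: zz'.
apply: leq_trans zz'm; apply: proper_card; apply/properP; split.
  apply/fintype.subsetP => j; rewrite !inE ffunE.
  by case: (j =P l) => [->|//]; rewrite eqxx.
by exists l; rewrite !inE // ffunE eqxx eqxx.
Qed.

Lemma interf_dep_refl y i : interf_dep y i i.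
Proof. by apply/existsP; exists i; rewrite interferes_refl. Qed.

End Interference.

(** * Symmetries and independence under paired randomization *)

Section PairedRandomization.
Context {R : realType} {n : nat} {D : design R n} {rho : 'I_n -> 'I_n}.
Context (paired : paired_randomization D rho).
Implicit Types (X Y : assignment n -> R) (i j l : 'I_n) (z : assignment n).

Let rhoK : involutive rho. Proof. by case: paired => [[]]. Qed.
Let rho_neq i : rho i != i. Proof. by case: paired => [[]]. Qed.
Let lawE z : D z = if [forall i, z i != z (rho i)] then 2 ^- n./2 else 0.
Proof. by case: paired. Qed.

Lemma paired_supp z : D z != 0 -> forall i, z (rho i) = ~~ z i.
Proof.
rewrite lawE; case: ifPn => [/forallP zP _ i|_]; last by rewrite eqxx.
by have := zP i; case: (z i); case: (z _).
Qed.

(** Both members of the pair are flipped, since flipping [i] alone would leave the support of the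
    design. *)
Definition flip_pair i z : assignment n :=
  [ffun j => z j (+) ((j == i) || (j == rho i))].

Lemma flip_pairK i : involutive (flip_pair i).
Proof. by move=> z; apply/ffunP => j; rewrite !ffunE -addbA addbb addbF. Qed.

Lemma flip_pair_id i z : flip_pair i z i = ~~ z i.
Proof. by rewrite ffunE eqxx addbT. Qed.

(** A pair is stable under [rho], so a unit and its partner are flipped together or not at all, and
    whether they disagree is preserved. *)
Lemma law_flip_pair i z : D (flip_pair i z) = D z.
Proof.
rewrite !lawE; congr (if _ then _ else _); apply: eq_forallb => j.
rewrite !ffunE (inj_eq (inv_inj rhoK)) (can2_eq rhoK rhoK).
rewrite [(j == rho i) || _]orbC.
by case: (_ || _); rewrite ?addbF ?addbT //; case: (z _); case: (z _).
Qed.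

Lemma Expect_flip_pair i X : Expect D (fun z => X (flip_pair i z)) = Expect D X.
Proof.
rewrite /Expect [RHS](reindex_inj (inv_inj (flip_pairK i))).
by apply: eq_bigr => z _; rewrite law_flip_pair.
Qed.

(** The flip preserves the law and exchanges the two values of Z_i, which are therefore equally
    likely. *)
Lemma ptreat_paired i : ptreat D i = 2^-1.
Proof.
have pE b : Prob D (fun z => z i == b) = Expect D (fun z => (z i == b)%:R).
  rewrite /Prob /Expect big_mkcond; apply: eq_bigr => z _ /=.
  by case: (_ == b); rewrite ?mulr1 ?mulr0.
have h1 : Expect D (fun z => (z i == false)%:R) = Expect D (fun z => (z i == true)%:R).
  rewrite -(Expect_flip_pair i); apply: eq_Expect => z.
  by rewrite flip_pair_id; case: (z i).
have : Expect D (fun z => (z i == true)%:R) + Expect D (fun z => (z i == false)%:R) = 1.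
  rewrite -ExpectD -[RHS](Expect_cst D); apply: eq_Expect => z /=.
  by case: (z i); rewrite ?addr0 ?add0r.
have -> : ptreat D i = Prob D (fun z => z i == true).
  by apply: eq_Prob_supp => z _; case: (z i).
by rewrite h1 pE; lra.
Qed.

Definition depends_on (A : {set 'I_n}) X :=
  forall z z', (forall l, l \in A -> z l = z' l) -> X z = X z'.

Definition mix (A : {set 'I_n}) z z' : assignment n :=
  [ffun l => if l \in A then z l else z' l].

(* Exchanging the coordinates in A between two independent copies of Z
   preserves their joint law. *)
Lemma Expect_indep (A : {set 'I_n}) X Y :
  (forall l, (rho l \in A) = (l \in A)) ->
  depends_on A X -> depends_on (~: A) Y ->
  Expect D (fun z => X z * Y z) = Expect D X * Expect D Y.
Proof.
move=> rhoA XA YA.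
pose swap (p : assignment n * assignment n) := (mix A p.1 p.2, mix A p.2 p.1).
have swapK : involutive swap.
  by move=> [z z'] /=; congr (_, _); apply/ffunP => l; rewrite !ffunE;
    case: (l \in A).
have law_swap p : D (swap p).1 * D (swap p).2 = D p.1 * D p.2.
  case: p => z z' /=.
  (* As a single condition over the units, the joint law is visibly invariant: [A] is stable under
     [rho], so at each [l] the swap either keeps the two conjuncts or exchanges them. *)
  have lawM (u v : assignment n) : D u * D v =
      if [forall l, (u l != u (rho l)) && (v l != v (rho l))]
      then (2 ^- n./2) ^+ 2 else 0.
    rewrite !lawE; case: ifPn => [/forallP uP|/fintype.forallPn[l ul]].
      case: ifPn => [/forallP vP|/fintype.forallPn[l vl]].
        by rewrite expr2 ifT //; apply/forallP => l; rewrite uP vP.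
      by rewrite ifN ?mulr0 //; apply/fintype.forallPn; exists l; rewrite (negPf vl) andbF.
    by rewrite mul0r ifN //; apply/fintype.forallPn; exists l; rewrite (negPf ul).
  rewrite !lawM; congr (if _ then _ else _); apply: eq_forallb => l.
  by rewrite !ffunE rhoA; case: ifP => // _; rewrite andbC.
(* A second independent copy of Z is introduced through its total mass 1. *)
transitivity (\sum_z \sum_z' D z * D z' * (X z * Y z)).
  apply: eq_bigr => z _; rewrite -mulr_suml -mulr_sumr law_sum1 mulr1 //.
rewrite pair_big /= (reindex_inj (inv_inj swapK)) /=.
transitivity (\sum_z \sum_z' D z * D z' * (X z * Y z')); last first.
  rewrite /Expect mulr_suml; apply: eq_bigr => z _; rewrite mulr_sumr.
  by apply: eq_bigr => z' _; rewrite mulrACA.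
rewrite [RHS]pair_big /=; apply: eq_bigr => -[z z'] _ /=.
rewrite (law_swap (z, z')) /=; congr (_ * (_ * _)).
  by apply: XA => l lA; rewrite ffunE lA.
by apply: YA => l; rewrite inE ffunE => /negPf ->.
Qed.

(** On the support [rho] exchanges treated and untreated units, so the two groups have equal
    size. *)
Lemma sum_treated_paired b z : D z != 0 ->
  \sum_i (z i == b)%:R = n%:R / 2 :> R.
Proof.
move=> /paired_supp zP.
have h : \sum_i (z i == b)%:R = \sum_i (z i != b)%:R :> R.
  rewrite (reindex_inj (inv_inj rhoK)); apply: eq_bigr => i _.
  by rewrite zP; case: (z i); case: b.
have : \sum_i (z i == b)%:R + \sum_i (z i != b)%:R = n%:R :> R.
  rewrite -big_split /= -[in RHS](card_ord n) -sumr_const.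
  by apply: eq_bigr => i _; case: eqP; rewrite ?addr0 ?add0r.
by rewrite -h; lra.
Qed.

(** * Bias and variance of the estimators *)

Context (y : 'I_n -> assignment n -> R).

Let W i z : R := 2 * (((z i)%:R - (~~ z i)%:R) * y i z).
Let V i z : R := W i z - Expect D (W i).

Let half_compl : 1 - 2^-1 = 2^-1 :> R. Proof. by lra. Qed.

Lemma tau_HT_paired z : tau_HT D y z = n%:R^-1 * \sum_i W i z.
Proof.
rewrite /tau_HT -mulrBr -sumrB; congr (_ * _); apply: eq_bigr => i _.
by rewrite /W ptreat_paired half_compl invrK; ring.
Qed.

Lemma tau_HA_paired z : D z != 0 -> tau_HA D y z = tau_HT D y z.
Proof.
(* For [n = 0] the Hajek denominators vanish, but all sums are empty and both estimators are 0. *)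
move=> zP; have [n0|n0] := posnP n.
  rewrite /tau_HA /tau_HT !big1 ?mul0r ?mulr0 // => i;
    by have := ltn_ord i; rewrite [X in (_ < X)%N]n0.
have S1 : \sum_i (z i)%:R / ptreat D i = n%:R.
  under eq_bigr => i _ do rewrite ptreat_paired invrK.
  rewrite -mulr_suml; under eq_bigr => i _ do rewrite -[z i]eqb_id.
  by rewrite (sum_treated_paired true zP) divfK // pnatr_eq0.
have S0 : \sum_i (~~ z i)%:R / (1 - ptreat D i) = n%:R.
  under eq_bigr => i _ do rewrite ptreat_paired half_compl invrK.
  rewrite -mulr_suml; under eq_bigr => i _ do rewrite -eqbF_neg.
  by rewrite (sum_treated_paired false zP) divfK // pnatr_eq0.
by rewrite /tau_HA /tau_HT S1 S0 ![_ / n%:R]mulrC.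
Qed.

Lemma Expect_VV_eq0 i j : ~~ interf_dep y i j -> ~~ pair_interf_dep y rho i j ->
  Expect D (fun z => V i z * V j z) = 0.
Proof.
move=> nd ne.
have WP l z z' : (forall m, interferes y m l -> z m = z' m) -> V l z = V l z'.
  move=> zz'; rewrite /V /W (outcome_local zz') (zz' l) //.
  exact: interferes_refl.
(* The set is the closure under [rho] of the units affecting [i]; it remains to see that no unit in
   it affects [j]. *)
rewrite (@Expect_indep [set l | interferes y l i || interferes y (rho l) i]%SET).
- by rewrite ExpectB Expect_cst subrr mul0r.
- by move=> l; rewrite !inE rhoK orbC.
- by move=> z z' zz'; apply: WP => l li; apply: zz'; rewrite inE li.
- move=> z z' zz'; apply: WP => l lj; apply: zz'; rewrite !inE negb_or.
  apply/andP; split.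
    by apply: contraNN nd => li; apply/existsP; exists l; rewrite li.
  (* In [pair_interf_dep] the witness affects [i] and its partner affects [j]; here these are
     [rho l] and [l]. *)
  apply: contraNN ne => li; apply/existsP; exists (rho l).
  by rewrite nd li rhoK lj.
Qed.

(* Flipping the pair of [i] leaves [y_i(b; Z_{-i})] unchanged when unit [rho i]
   does not affect unit [i], so this variable is uncorrelated with [Z_i]. *)
Lemma arm_bias_le (K : R) i b :
  Expect D (fun z => `|y i (insert_unit i b (delete_unit i z))|) <= K ->
  `|2 * Expect D (fun z => (z i == b)%:R * y i z) -
    Expect D (fun z => y i (insert_unit i b (delete_unit i z)))| <=
  K * (interferes y (rho i) i)%:R.
Proof.
move=> uK; pose u z := y i (insert_unit i b (delete_unit i z)).
(* On the event Z_i = b, inserting [b] at [i] changes nothing. *)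
have yu : Expect D (fun z => (z i == b)%:R * y i z) =
          Expect D (fun z => (z i == b)%:R * u z).
  apply: eq_Expect => z; rewrite /u insert_delete_unit.
  have [<-|_] := eqVneq (z i) b; rewrite ?mul0r // !mul1r; congr (y i _).
  by apply/ffunP => j; rewrite ffunE; case: eqP => [->|].
rewrite yu -/u -ExpectM -ExpectB.
have [_|nri] := boolP (interferes y (rho i) i); last first.
  rewrite mulr0 normr_le0 ExpectB ExpectM subr_eq0; apply/eqP.
  have -> : Expect D u = Expect D (fun z => (z i == b)%:R * u z) +
                         Expect D (fun z => (z i != b)%:R * u z).
    rewrite -ExpectD; apply: eq_Expect => z.
    by case: eqP; rewrite mul1r mul0r ?addr0 ?add0r.
  suff -> : Expect D (fun z => (z i != b)%:R * u z) =
            Expect D (fun z => (z i == b)%:R * u z) by ring.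
  rewrite -(Expect_flip_pair i); apply: eq_Expect => z.
  rewrite flip_pair_id; congr (_ * _); first by case: (z i); case: b {u uK yu}.
  apply: outcome_local => l li; rewrite !insert_delete_unit !ffunE.
  case: eqP => // _; case: eqP => [lr|]; last by rewrite addbF.
  by rewrite -lr li in nri.
rewrite mulr1 (le_trans _ uK) // (le_trans (ler_norm_Expect _ _)) //.
apply: le_Expect => z; rewrite -/(u z).
(* Twice an indicator minus 1 is a sign, so the bias is at most the first absolute moment of [u]. *)
have -> : 2 * ((z i == b)%:R * u z) - u z = (-1) ^+ (z i != b) * u z.
  by case: eqP => _ /=; ring.
by rewrite normrMsign.
Qed.

(** Bias-variance decomposition: [n] times the error is [S + B], where [S] is the sum of the
    centered [V i] and the constant [B] is the sum of the unit biases. *)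
Lemma mean_square_HT (K : R) :
  (0 < n)%N ->
  (forall i, Expect D (fun z => y i z ^+ 2) <= K) ->
  (forall i b,
     Expect D (fun z => `|y i (insert_unit i b (delete_unit i z))|) <= K) ->
  Expect D (fun z => (tau_HT D y z - tau_EATE D y) ^+ 2) <=
  (4 * K + 4 * K ^+ 2) *
    (d_avg y / n%:R + e_avg y rho / n%:R + (R_sum y rho / n%:R) ^+ 2).
Proof.
move=> n0 y2K uK.
have nR0 : n%:R != 0 :> R by rewrite pnatr_eq0 -lt0n.
have K0 : 0 <= K.
  apply: (le_trans _ (y2K (Ordinal n0))).
  by rewrite -[X in X <= _](Expect_cst D); apply: le_Expect => z; exact: sqr_ge0.
pose u i b z := y i (insert_unit i b (delete_unit i z)).
pose theta i := Expect D (fun z => u i true z - u i false z).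
have V2 i : Expect D (fun z => V i z ^+ 2) <= 4 * K.
  rewrite Expect_sqr_centered.
  apply: (@le_trans _ _ (Expect D (fun z => W i z ^+ 2))).
    by rewrite gerBl sqr_ge0.
  (* The factor Z_i - (1 - Z_i) is a sign and disappears in the square. *)
  rewrite (@eq_Expect _ _ D _ (fun z => 4 * y i z ^+ 2)).
    by rewrite ExpectM ler_wpM2l.
  by move=> z; rewrite /W; case: (z i) => /=; ring.
have VV_le i j : Expect D (fun z => V i z * V j z) <=
    4 * K * ((interf_dep y i j)%:R + (pair_interf_dep y rho i j)%:R).
  have [/norP[nd ne]|de] := boolP (~~ (interf_dep y i j || pair_interf_dep y rho i j)).
    by rewrite Expect_VV_eq0 // (negPf nd) (negPf ne) addr0 mulr0.
  (* At least one of the two indicators is 1, so the covariance need only be bounded by [4 * K],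
     which follows from ab <= (a^2 + b^2) / 2. *)
  apply: (@le_trans _ _ (4 * K)); last first.
    rewrite ler_peMr ?mulr_ge0 // -natrD ler1n addn_gt0 !lt0b.
    by rewrite negbK in de.
  apply: (@le_trans _ _ (2^-1 * (Expect D (fun z => V i z ^+ 2) +
                                 Expect D (fun z => V j z ^+ 2)))).
    rewrite -ExpectD -ExpectM; apply: le_Expect => z.
    by have := sqr_ge0 (V i z - V j z); nra.
  by have := V2 i; have := V2 j; lra.
have b_le i : `|Expect D (W i) - theta i| <= 2 * K * (interferes y (rho i) i)%:R.
  (* The bias splits into one term per treatment arm, each at most [K], whence the factor 2. *)
  have -> : Expect D (W i) - theta i =
      (2 * Expect D (fun z => (z i == true)%:R * y i z) - Expect D (u i true)) -
      (2 * Expect D (fun z => (z i == false)%:R * y i z) - Expect D (u i false)).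
    rewrite /theta ExpectB.
    have -> : Expect D (W i) = 2 * Expect D (fun z => (z i == true)%:R * y i z) -
        2 * Expect D (fun z => (z i == false)%:R * y i z).
      by rewrite -mulrBr -ExpectB -ExpectM; apply: eq_Expect => z;
        rewrite /W; case: (z i) => /=; ring.
    by ring.
  have t_le := arm_bias_le (uK i true).
  have f_le := arm_bias_le (uK i false).
  apply: (le_trans (ler_normB _ _)); apply: (le_trans (lerD t_le f_le)).
  by rewrite le_eqVlt; apply/orP; left; apply/eqP; ring.
have B_le : `|\sum_i (Expect D (W i) - theta i)| <= 2 * K * R_sum y rho.
  rewrite /R_sum mulr_sumr; apply: (le_trans (ler_norm_sum _ _ _)).
  exact: ler_sum.
have S_le : Expect D (fun z => (\sum_i V i z) ^+ 2) <=
    4 * K * (n%:R * d_avg y + n%:R * e_avg y rho).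
  rewrite /d_avg /e_avg !mulrA divff // !mul1r -big_split mulr_sumr /=.
  rewrite (@eq_Expect _ _ D _ (fun z => \sum_i \sum_j V i z * V j z)); last first.
    by move=> z; rewrite expr2 mulr_suml; apply: eq_bigr => i _; rewrite mulr_sumr.
  rewrite Expect_sum; apply: ler_sum => i _.
  by rewrite Expect_sum -big_split mulr_sumr; apply: ler_sum => j _.
have S0 : Expect D (fun z => \sum_i V i z) = 0.
  by rewrite Expect_sum big1 // => i _; rewrite ExpectB Expect_cst subrr.
set S := fun z => \sum_i V i z in S_le S0.
set B := \sum_i _ in B_le.
(* The square is expanded so that the cross term drops out, [S] having mean 0. *)
rewrite (@eq_Expect _ _ D _ (fun z =>
  n%:R ^- 2 * (S z ^+ 2 + 2 * B * S z + B ^+ 2))); last first.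
  move=> z; rewrite tau_HT_paired /tau_EATE.
  have -> : \sum_i W i z = S z + \sum_i Expect D (W i).
    by rewrite -big_split; apply: eq_bigr => i _ /=; rewrite /V subrK.
  by rewrite -mulrBr -addrA -sumrB -/theta -/B; field.
rewrite ExpectM !ExpectD ExpectM Expect_cst S0 mulr0 addr0.
have B2_le : B ^+ 2 <= 4 * K ^+ 2 * R_sum y rho ^+ 2.
  rewrite -[B ^+ 2]real_normK ?num_real //.
  apply: (le_trans (lerXn2r _ _ _ B_le)); rewrite ?nnegrE //.
    by rewrite (le_trans (normr_ge0 B)).
  by rewrite !exprMn -natrX.
have d0 : 0 <= d_avg y.
  by rewrite mulr_ge0 ?invr_ge0 // sumr_ge0 // => i _; rewrite sumr_ge0.
have e0 : 0 <= e_avg y rho.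
  by rewrite mulr_ge0 ?invr_ge0 // sumr_ge0 // => i _; rewrite sumr_ge0.
rewrite mulrC ler_pdivrMr ?exprn_gt0 ?ltr0n //.
apply: (le_trans (lerD S_le B2_le)).
have -> : (4 * K + 4 * K ^+ 2) *
   (d_avg y / n%:R + e_avg y rho / n%:R + (R_sum y rho / n%:R) ^+ 2) * n%:R ^+ 2 =
   (4 * K + 4 * K ^+ 2) *
   (n%:R * d_avg y + n%:R * e_avg y rho + R_sum y rho ^+ 2) by field.
have de0 : 0 <= n%:R * d_avg y + n%:R * e_avg y rho.
  by rewrite addr_ge0 // mulr_ge0.
(* The variance constant [4 * K] and the bias constant [4 * K ^+ 2] are both enlarged to their
   sum. *)
by have := sqr_ge0 (R_sum y rho); nra.
Qed.
End PairedRandomization.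

(** * From mean square bounds to convergence and rates in probability *)

Section ConvergenceInProbability.
Context {R : realType} (D : forall n, design R n).
Implicit Types X : forall n, assignment n -> R.

Lemma cvg_in_prob0_mean_square X (v : nat -> R) :
  (\forall n \near even_oo, Expect (D n) (fun z => X n z ^+ 2) <= v n) ->
  v n @[n --> even_oo] --> (0 : R) -> cvg_in_prob0 D X.
Proof.
move=> Xv v0 eps eps0.
have : v n / eps ^+ 2 @[n --> even_oo] --> (0 : R).
  by rewrite -[0 in X in _ --> X](mul0r (eps ^- 2)); apply: cvgMl.
apply: squeeze_cvgr (cvg_cst 0); near=> n; rewrite Prob_ge0 /=.
rewrite (le_trans (Chebyshev _ _ eps0)) // ler_pM2r ?invr_gt0 ?exprn_gt0 //.
by near: n.
Unshelve. all: by end_near. Qed.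

Lemma bigO_p_mean_square X (a : nat -> R) (C : R) :
  (\forall n \near even_oo,
     0 < a n /\ Expect (D n) (fun z => X n z ^+ 2) <= C * a n ^+ 2) ->
  bigO_p D X a.
Proof.
(* Chebyshev's inequality at the threshold [M * a n] bounds the probability by C / M^2. With c = |C|
   / eps and M = 1 + c one has M^2 >= c, hence C <= eps M^2; the summand 1 keeps the threshold
   positive. *)
move=> aX eps eps0; exists (1 + `|C| / eps).
have M1 : 1 <= 1 + `|C| / eps by rewrite lerDl divr_ge0 // ltW.
have CM : C <= eps * (1 + `|C| / eps) ^+ 2.
  have CE : `|C| = eps * (`|C| / eps) by rewrite mulrC divfK ?gt_eqF.
  have := ler_norm C; rewrite [X in _ <= X]CE; move: M1; set c := `|C| / eps => M1 CC.
  have : 0 <= eps * (1 + c + c ^+ 2).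
    by rewrite mulr_ge0 ?ltW //; have := sqr_ge0 c; lra.
  lra.
near=> n; have [an Xn] : 0 < a n /\ Expect (D n) (fun z => X n z ^+ 2) <= C * a n ^+ 2.
  by near: n.
have Ma : 0 < (1 + `|C| / eps) * a n by rewrite mulr_gt0 // (lt_le_trans _ M1).
rewrite (le_trans (Chebyshev _ _ Ma)) // ler_pdivrMr ?exprn_gt0 //.
by rewrite (le_trans Xn) // exprMn [leRHS]mulrA ler_pM2r // exprn_gt0.
Unshelve. all: by end_near. Qed.

Lemma near_even_gt0 : \forall n \near even_oo, ~~ odd n /\ (0 < n)%N.
Proof.
rewrite near_withinE; near=> n => /= ->; split => //.
by near: n; exact: nbhs_infty_gt.
Unshelve. all: by end_near. Qed.

Lemma littleo_natr_cvg0 (f : nat -> R) :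
  f =o_even_oo (fun n => n%:R : R) -> f n / n%:R @[n --> even_oo] --> (0 : R).
Proof.
move=> /eqoP fo; apply/cvgrPdist_le => eps eps0; near=> n.
have n0 : (0 < n)%N.
  have [//] : ~~ odd n /\ (0 < n)%N by near: n; exact: near_even_gt0.
rewrite sub0r normrN normf_div ler_pdivrMr ?normr_gt0 ?pnatr_eq0 -?lt0n //.
by near: n; exact: fo.
Unshelve. all: by end_near. Qed.

End ConvergenceInProbability.

Theorem proposition4 (R : realType)
    (y : forall n : nat, 'I_n -> assignment n -> R)
    (rho : forall n : nat, 'I_n -> 'I_n)
    (D : forall n : nat, design R n)
    (paired : forall n : nat, ~~ odd n -> paired_randomization (D n) (rho n))
    (reg : regularity D y)
    (restricted_interference :
      (fun n : nat => d_avg (y n)) =o_even_oo (fun n : nat => n%:R : R))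
    (restricted_pair_interference :
      (fun n : nat => e_avg (y n) (rho n)) =o_even_oo (fun n : nat => n%:R : R))
    (pair_separation :
      (fun n : nat => R_sum (y n) (rho n)) =o_even_oo (fun n : nat => n%:R : R)) :
  let HT_error (n : nat) (z : assignment n) : R :=
    tau_HT (D n) (y n) z - tau_EATE (D n) (y n) in
  let HA_error (n : nat) (z : assignment n) : R :=
    tau_HA (D n) (y n) z - tau_EATE (D n) (y n) in
  let rate (n : nat) : R :=
    Num.sqrt (d_avg (y n)) / Num.sqrt n%:R +
    Num.sqrt (e_avg (y n) (rho n)) / Num.sqrt n%:R +
    R_sum (y n) (rho n) / n%:R in
  [/\ cvg_in_prob0 D HT_error,
      cvg_in_prob0 D HA_error,
      bigO_p D HT_error rate &
      bigO_p D HA_error rate].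
Proof.
move=> HT_error HA_error rate; have [k [q [s [k0 q2 s1 regk]]]] := reg.
(* This [K] bounds both the second moments of the outcomes, through [q], and the first absolute
   moments of the inserted outcomes, through [s]. *)
pose K := 1 + k `^ q + k `^ s.
pose C := 4 * K + 4 * K ^+ 2.
have K0 : 0 <= K by rewrite !addr_ge0 ?powR_ge0.
have C0 : 0 <= C by rewrite addr_ge0 // mulr_ge0 ?sqr_ge0.
pose v n := C * (d_avg (y n) / n%:R + e_avg (y n) (rho n) / n%:R +
                 (R_sum (y n) (rho n) / n%:R) ^+ 2).
have HT_v n : ~~ odd n -> (0 < n)%N ->
    Expect (D n) (fun z => HT_error n z ^+ 2) <= v n.
  move=> on n0; apply: (mean_square_HT (paired n on) (K := K)) => // i.
    have [_ yq _] := regk n on i.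
    apply: (@le_trans _ _ (1 + k `^ q)); last by rewrite lerDl powR_ge0.
    apply: le_trans (lerD (lexx 1) yq).
    rewrite -[X in X + _](Expect_cst (D n)) -ExpectD; apply: le_Expect => z.
    by rewrite -[_ ^+ 2]real_normK ?num_real // expr_le1D_powR.
  move=> b; have [_ _ ys] := regk n on i.
  apply: (@le_trans _ _ (1 + k `^ s)); last by rewrite /K addrAC lerDl powR_ge0.
  apply: le_trans (lerD (lexx 1) (ys b)).
  rewrite -[X in X + _](Expect_cst (D n)) -ExpectD; apply: le_Expect => z.
  by rewrite -[X in X <= _]expr1 expr_le1D_powR.
have HA_v n : ~~ odd n -> (0 < n)%N ->
    Expect (D n) (fun z => HA_error n z ^+ 2) <= v n.
  move=> on n0; apply: le_trans (HT_v n on n0).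
  rewrite le_eqVlt; apply/orP; left; apply/eqP.
  by apply: eq_Expect_supp => z Dz; rewrite /HA_error (tau_HA_paired (paired n on)).
have v0 : v n @[n --> even_oo] --> (0 : R).
  rewrite -(mulr0 C); apply: cvgMr; rewrite -[0]addr0 -{1}[0](addr0 0).
  apply: cvgD; first by apply: cvgD; exact: littleo_natr_cvg0.
  by rewrite -[X in _ --> X](mulr0 (0 : R)); apply: cvgM; exact: littleo_natr_cvg0.
have rate_v n : (0 < n)%N -> 0 < rate n /\ v n <= C * rate n ^+ 2.
  move=> n0.
  (* The diagonal terms d_ii = 1 make the rate strictly positive, as Chebyshev's inequality
     requires. *)
  have d0 : 0 < d_avg (y n) :> R.
    rewrite mulr_gt0 ?invr_gt0 ?ltr0n // (bigD1 (Ordinal n0)) //= (bigD1 (Ordinal n0)) //=.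
    rewrite interf_dep_refl -addrA ltr_pwDl // addr_ge0 ?sumr_ge0 // => i _.
    by rewrite sumr_ge0.
  have e0 : 0 <= e_avg (y n) (rho n) :> R.
    by rewrite mulr_ge0 ?invr_ge0 // sumr_ge0 // => i _; rewrite sumr_ge0.
  have R0 : 0 <= R_sum (y n) (rho n) :> R by rewrite sumr_ge0.
  have sqrt_ratio (a : R) : 0 <= a -> a / n%:R = (Num.sqrt a / Num.sqrt n%:R) ^+ 2.
    by move=> a0; rewrite expr_div_n !sqr_sqrtr.
  have sd : 0 < Num.sqrt (d_avg (y n)) / Num.sqrt n%:R :> R.
    by rewrite divr_gt0 ?sqrtr_gt0 ?ltr0n.
  have se : 0 <= Num.sqrt (e_avg (y n) (rho n)) / Num.sqrt n%:R :> R.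
    by rewrite divr_ge0 ?sqrtr_ge0.
  have sR : 0 <= R_sum (y n) (rho n) / n%:R :> R by rewrite divr_ge0.
  split; first by rewrite /rate -addrA ltr_pwDl // addr_ge0.
  rewrite /v ler_wpM2l // (sqrt_ratio _ (ltW d0)) (sqrt_ratio _ e0) /rate.
  (* What remains is a^2 + b^2 + c^2 <= (a + b + c)^2, true because the cross products are
     nonnegative. *)
  move: sd se sR; move: (_ / _) (_ / _) (_ / _) => a b c a0 b0 c0.
  have := mulr_ge0 (ltW a0) b0; have := mulr_ge0 (ltW a0) c0.
  by have := mulr_ge0 b0 c0; rewrite !expr2; lra.
split.
- apply: (cvg_in_prob0_mean_square _ v0).
  by apply: filterS near_even_gt0 => n [on n0]; exact: HT_v.
- apply: (cvg_in_prob0_mean_square _ v0).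
  by apply: filterS near_even_gt0 => n [on n0]; exact: HA_v.
- apply: (@bigO_p_mean_square _ _ _ _ C); apply: filterS near_even_gt0 => n [on n0].
  by have [r0 vr] := rate_v n n0; split=> //; exact: le_trans (HT_v n on n0) vr.
- apply: (@bigO_p_mean_square _ _ _ _ C); apply: filterS near_even_gt0 => n [on n0].
  by have [r0 vr] := rate_v n n0; split=> //; exact: le_trans (HA_v n on n0) vr.
Qed.
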